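(* Let $h,c,K>0$ be constants with $3-2h^2K^2>0$, and let $(q_1(t),q_2(t))$, $t\in\mathbb{R}$, be a solution of $$\begin{aligned} \dot q_1&=\frac{4ch^2K^2}{3\cosh^2\left[K\left(q_1-(1+\frac23h^2K^2)\,ct\right)\right]},\\ \dot q_2&=(q_2+h)\,\frac{8ch^2K^3\sinh\left[K\left(q_1-(1+\frac23h^2K^2)\,ct\right)\right]}{3\cosh^3\left[K\left(q_1-(1+\frac23h^2K^2)\,ct\right)\right]}. \end{aligned}$$ Then the quantity $$q_1(t)+\frac{2h}{\sqrt{3-2h^2K^2}}\arctan\left[\frac{2hK\tanh\left[K\left(q_1(t)-(1+\frac23h^2K^2)\,ct\right)\right]}{\sqrt{3-2h^2K^2}}\right]$$ is constant in $t$, the limits $q_1(\pm\infty)=\lim_{t\to\pm\infty}q_1(t)$ satisfy $$q_1(\infty)-q_1(-\infty)=\frac{4h}{\sqrt{3-2h^2K^2}}\arctan\left[\frac{2hK}{\sqrt{3-2h^2K^2}}\right],$$ and the trajectories $(q_1(t),q_2(t))$ are bounded.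
   Context: The system describes the position $(q_1,q_2)$ of a point vortex in fluid of depth $h$ moving according to $\dot q_1=\mathfrak u(q_1,t)$, $\dot q_2=-(q_2+h)\,\mathfrak u_x(q_1,t)$ under the unperturbed KdV soliton $\mathfrak u(x,t)=\frac{4ch^2K^2}{3\cosh^2[K(x-(1+\frac23h^2K^2)ct)]}$ (soliton parameters $K$ and $x_0=0$), where $c=\sqrt{gh}$ and $g>0$ is the gravitational acceleration. *)

(* Defs.v *)
From Stdlib Require Import Reals.
From Coquelicot Require Import Coquelicot.
Open Scope R_scope.

(* The argument K (x - (1 + (2/3) h^2 K^2) c t) of the KdV soliton. *)
Definition phase (h c K x t : R) : R :=
  K * (x - (1 + 2 / 3 * h ^ 2 * K ^ 2) * c * t).

Definition vortex_solution (h c K : R) (q1 q2 : R -> R) : Prop :=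
  forall t : R,
    is_derive q1 t
      (4 * c * h ^ 2 * K ^ 2 / (3 * cosh (phase h c K (q1 t) t) ^ 2)) /\
    is_derive q2 t
      ((q2 t + h) *
       (8 * c * h ^ 2 * K ^ 3 * sinh (phase h c K (q1 t) t) /
        (3 * cosh (phase h c K (q1 t) t) ^ 3))).

Definition vortex_invariant (h c K x t : R) : R :=
  x + 2 * h / sqrt (3 - 2 * h ^ 2 * K ^ 2) *
      atan (2 * h * K * tanh (phase h c K x t) / sqrt (3 - 2 * h ^ 2 * K ^ 2)).

(* Main.v *)
(** Along a solution the phase [th] solves the autonomous equation
    [th' = - (K c / 3) w(th)], where [w(th) = 3 + 2 a - 4 a / cosh^2 th] and
    [a = h^2 K^2]; moreover [w >= 3 - 2 a > 0].  Differentiating shows that both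
    the stated quantity and [(q2 + h) w(th)] are constant.  Since [atan] is
    bounded, the first conservation law bounds [q1]; hence [th] tends to
    [-oo] and [+oo] as [t] tends to [+oo] and [-oo], which gives the limits of
    [q1].  The second one bounds [q2] because [w] is bounded below. *)

Require Import Defs.
From Stdlib Require Import Reals Lra.
From Coquelicot Require Import Coquelicot.
Open Scope R_scope.

Lemma is_derive_0_const (f : R -> R) :
  (forall t, is_derive f t 0) -> forall t, f t = f 0.
Proof.
intros Hf t.
(* [eq_is_derive] needs strictly ordered endpoints, hence the case split. *)
destruct (Rtotal_order t 0) as [Ht | [-> | Ht]].
- now apply eq_is_derive; [intros s _; apply Hf|].
- reflexivity.
- now symmetry; apply eq_is_derive; [intros s _; apply Hf|].
Qed.

Lemma cosh_pos (x : R) : 0 < cosh x.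
Proof.
unfold cosh; pose proof (exp_pos x); pose proof (exp_pos (- x)); lra.
Qed.

Lemma cosh_sqr (x : R) : cosh x ^ 2 = 1 + sinh x ^ 2.
Proof.
unfold cosh, sinh.
assert (E : exp x * exp (- x) = 1) by (rewrite <- exp_plus, Rplus_opp_r; apply exp_0).
replace 1 with (exp x * exp (- x)); field.
Qed.

Lemma tanh_opp (x : R) : tanh (- x) = - tanh x.
Proof.
unfold tanh, sinh, cosh; rewrite Ropp_involutive.
pose proof (exp_pos x); pose proof (exp_pos (- x)); field; lra.
Qed.

(** As a rational function of [exp x], [tanh] extends continuously to the value 0 that [exp]
    approaches at [m_infty]. *)
Lemma is_lim_tanh_m : is_lim tanh m_infty (-1).
Proof.
apply (is_lim_ext (fun x => (exp x ^ 2 - 1) / (exp x ^ 2 + 1))).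
- intro x; unfold tanh, sinh, cosh; rewrite exp_Ropp.
  pose proof (exp_pos x); field; split; nra.
- replace (-1) with ((0 ^ 2 - 1) / (0 ^ 2 + 1)) by field.
  apply (is_lim_comp_continuous exp (fun y => (y ^ 2 - 1) / (y ^ 2 + 1))).
  + apply is_lim_exp_m.
  + apply @ex_derive_continuous; auto_derive; lra.
Qed.

Lemma is_lim_tanh_p : is_lim tanh p_infty 1.
Proof.
apply (is_lim_ext (fun x => - tanh (- x))).
- intro x; rewrite tanh_opp; ring.
- replace (Finite 1) with (Rbar_opp (-1)) by (simpl; f_equal; ring).
  apply is_lim_opp, (is_lim_comp tanh Ropp _ _ m_infty).
  + apply is_lim_tanh_m.
  + apply (is_lim_opp (fun x => x) p_infty p_infty), is_lim_id.
  + now exists 0.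
Qed.

(** The linear term dominates a bounded one. For [q1] and the soliton speed [V], the function is the
    phase. *)
Lemma bounded_minus_linear_lim (q : R -> R) (K V M : R) :
  0 < K -> 0 < V -> (forall t, Rabs (q t) <= M) ->
  is_lim (fun t => K * (q t - V * t)) p_infty m_infty /\
  is_lim (fun t => K * (q t - V * t)) m_infty p_infty.
Proof.
intros HK HV Hq.
split; apply is_lim_spec; intro N.
(* Beyond this time [M - V * t < N / K], and [q t <= M]. *)
- exists ((M - N / K) / V); intros t Ht.
  apply Rlt_div_l in Ht; [|easy].
  apply (Rmult_lt_reg_r (/ K)); [now apply Rinv_0_lt_compat|].
  replace (K * (q t - V * t) * / K) with (q t - V * t) by (field; lra).
  change (q t - V * t < N / K).
  pose proof (proj1 (Rabs_le_between _ _) (Hq t)); lra.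
- exists ((- M - N / K) / V); intros t Ht.
  apply Rlt_div_r in Ht; [|easy].
  apply (Rmult_lt_reg_r (/ K)); [now apply Rinv_0_lt_compat|].
  replace (K * (q t - V * t) * / K) with (q t - V * t) by (field; lra).
  change (N / K < q t - V * t).
  pose proof (proj1 (Rabs_le_between _ _) (Hq t)); lra.
Qed.

Section Vortex.

Variables (h c K : R) (q1 q2 : R -> R).
Hypotheses (hh : 0 < h) (hc : 0 < c) (hK : 0 < K).
Hypothesis hhK : 0 < 3 - 2 * h ^ 2 * K ^ 2.
Hypothesis hq : vortex_solution h c K q1 q2.

Let s := sqrt (3 - 2 * h ^ 2 * K ^ 2).
Let th (t : R) := phase h c K (q1 t) t.
(** [- (c / 3) * w] is the horizontal velocity of the vortex in the frame of the soliton. *)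
Let w (x : R) := 3 + 2 * h ^ 2 * K ^ 2 - 4 * h ^ 2 * K ^ 2 / cosh x ^ 2.

Local Lemma s_pos : 0 < s.
Proof. now apply sqrt_lt_R0. Qed.

Local Lemma s_sqr : s ^ 2 = 3 - 2 * h ^ 2 * K ^ 2.
Proof. apply pow2_sqrt; lra. Qed.

(** The subtracted term is largest at the crest [x = 0], where [cosh x ^ 2] takes its minimum 1. *)
Local Lemma w_ge (x : R) : 3 - 2 * h ^ 2 * K ^ 2 <= w x.
Proof.
unfold w.
assert (Hc : 1 <= cosh x ^ 2) by (rewrite cosh_sqr; nra).
assert (/ cosh x ^ 2 <= 1) by (rewrite <- Rinv_1; apply Rinv_le_contravar; lra).
assert (0 < h ^ 2 * K ^ 2) by (apply Rmult_lt_0_compat; now apply pow_lt).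
unfold Rdiv; nra.
Qed.

Local Lemma is_derive_phase (t : R) : is_derive th t (- (K * c / 3) * w (th t)).
Proof.
destruct (hq t) as [H1 _].
unfold th, phase; auto_derive.
- now eexists; apply H1.
- rewrite (is_derive_unique (fun x : R => q1 x : R) _ _ H1).
  unfold w; pose proof (cosh_pos (phase h c K (q1 t) t)).
  change (K * (q1 t - (1 + 2 / 3 * h ^ 2 * K ^ 2) * c * t)) with (phase h c K (q1 t) t).
  field; lra.
Qed.

Local Lemma invariant_const (t : R) :
  vortex_invariant h c K (q1 t) t = vortex_invariant h c K (q1 0) 0.
Proof.
apply (is_derive_0_const (fun t => vortex_invariant h c K (q1 t) t)); clear t.
intro t; destruct (hq t) as [H1 _]; pose proof (is_derive_phase t) as Hth.
unfold vortex_invariant, tanh; fold s.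
(* Folding the phase into [th] lets [auto_derive] treat it as a single function, with derivative
   given by [Hth]. *)
apply (is_derive_ext (fun t => q1 t + 2 * h / s *
  atan (2 * h * K * (sinh (th t) / cosh (th t)) / s))); [reflexivity|].
pose proof (cosh_pos (th t)); pose proof s_pos.
auto_derive.
- repeat split; try lra.
  + now eexists; apply H1.
  + now eexists; apply Hth.
  + now eexists; apply Hth.
- rewrite (is_derive_unique (fun x : R => q1 x : R) _ _ H1).
  rewrite (is_derive_unique (fun x : R => th x : R) _ _ Hth).
  fold (th t); unfold w.
  set (C := cosh (th t)) in *; set (S := sinh (th t)).
  assert (ES : S ^ 2 = C ^ 2 - 1) by (unfold S, C; rewrite cosh_sqr; ring).
  assert (Hs : s ^ 2 = 3 - 2 * h ^ 2 * K ^ 2) by apply s_sqr.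
  (* [P] is [C ^ 2 * w (th t)]. By [ES] it is also [C ^ 2 * s ^ 2 * (1 + u ^ 2)], with [u] the
     argument of [atan]; so the derivative of [atan] cancels the factor [w] in that of [th]. *)
  set (P := C ^ 2 * (3 + 2 * h ^ 2 * K ^ 2) - 4 * h ^ 2 * K ^ 2).
  replace (3 + 2 * h ^ 2 * K ^ 2 - 4 * h ^ 2 * K ^ 2 / C ^ 2) with (P / C ^ 2)
    by (unfold P; field; lra).
  assert (EP : P = C ^ 2 * s ^ 2 + 4 * h ^ 2 * K ^ 2 * S ^ 2)
    by (unfold P; rewrite ES, Hs; ring).
  assert (0 < P).
  { assert (0 < C ^ 2 * s ^ 2) by (apply Rmult_lt_0_compat; now apply pow_lt).
    assert (0 <= (2 * h * K * S) ^ 2) by apply pow2_ge_0.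
    rewrite EP; lra. }
  replace (1 + 2 * h * K * (S * / C) * / s * (2 * h * K * (S * / C) * / s * 1))
    with (P / (C ^ 2 * s ^ 2)) by (rewrite EP; field; lra).
  field_simplify_eq; [|lra].
  rewrite ES; ring.
Qed.

(** By the equation for [th], the derivative of [w (th t)] is [w (th t)] times the opposite of the
    coefficient of [q2 t + h] in the second equation of motion. *)
Local Lemma momentum_const (t : R) : (q2 t + h) * w (th t) = (q2 0 + h) * w (th 0).
Proof.
apply (is_derive_0_const (fun t => (q2 t + h) * w (th t))); clear t.
intro t; destruct (hq t) as [_ H2]; pose proof (is_derive_phase t) as Hth.
pose proof (cosh_pos (th t)).
assert (cosh (th t) ^ 2 <> 0) by (apply pow_nonzero; lra).
unfold w; auto_derive.
- repeat split; try (simpl in *; lra).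
  + now eexists; apply H2.
  + now eexists; apply Hth.
- rewrite (is_derive_unique (fun x : R => q2 x : R) _ _ H2).
  rewrite (is_derive_unique (fun x : R => th x : R) _ _ Hth).
  fold (th t); unfold w; field; lra.
Qed.

Local Lemma q1_eq (t : R) :
  q1 t = vortex_invariant h c K (q1 0) 0
         - 2 * h / s * atan (2 * h * K * tanh (th t) / s).
Proof.
rewrite <- (invariant_const t); unfold vortex_invariant; fold s; fold (th t); ring.
Qed.

Local Lemma q1_bounded : exists M, forall t, Rabs (q1 t) <= M.
Proof.
set (A := 2 * h / s).
assert (0 < A) by (pose proof s_pos; apply Rdiv_lt_0_compat; lra).
exists (Rabs (vortex_invariant h c K (q1 0) 0) + A * (PI / 2)); intro t.
rewrite q1_eq; unfold Rminus.
eapply Rle_trans; [apply Rabs_triang|apply Rplus_le_compat_l].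
fold A; rewrite Rabs_Ropp, Rabs_mult, (Rabs_pos_eq A) by lra.
apply Rmult_le_compat_l; [lra|].
apply Rabs_le; pose proof (atan_bound (2 * h * K * tanh (th t) / s)); lra.
Qed.

Local Lemma q2_bounded : exists M, forall t, Rabs (q2 t) <= M.
Proof.
set (D := (q2 0 + h) * w (th 0)).
exists (Rabs D / (3 - 2 * h ^ 2 * K ^ 2) + h); intro t.
pose proof (w_ge (th t)) as Hw.
assert (Rabs (q2 t + h) <= Rabs D / (3 - 2 * h ^ 2 * K ^ 2)).
{ apply Rle_div_r; [easy|].
  unfold D; rewrite <- (momentum_const t), Rabs_mult, (Rabs_pos_eq (w _)) by lra.
  apply Rmult_le_compat_l; [apply Rabs_pos|easy]. }
replace (q2 t) with ((q2 t + h) + - h) by ring.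
eapply Rle_trans; [apply Rabs_triang|].
rewrite Rabs_Ropp, (Rabs_pos_eq h); lra.
Qed.

(** Passes to the limit in [q1_eq]. The last hypothesis is the side condition for composing limits;
    it is trivial for the infinite [y] used below. *)
Local Lemma q1_lim (x y : Rbar) (l : R) :
  is_lim th x y -> is_lim tanh y l -> Rbar_locally' x (fun t => Finite (th t) <> y) ->
  is_lim q1 x (vortex_invariant h c K (q1 0) 0 - 2 * h / s * atan (2 * h * K * l / s)).
Proof.
intros Hth Hl Hy.
eapply is_lim_ext; [intro t; symmetry; apply q1_eq|].
apply (is_lim_comp_continuous (fun t => tanh (th t)) (fun y =>
  vortex_invariant h c K (q1 0) 0 - 2 * h / s * atan (2 * h * K * y / s))).
- now apply (is_lim_comp tanh th x l y).
- pose proof s_pos; apply @ex_derive_continuous; auto_derive; lra.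
Qed.

(** The soliton moves at constant positive speed while [q1] stays bounded, so it comes from behind
    the vortex and leaves it behind. *)
Local Lemma phase_lim : is_lim th p_infty m_infty /\ is_lim th m_infty p_infty.
Proof.
destruct q1_bounded as [M HM].
apply (bounded_minus_linear_lim q1 K ((1 + 2 / 3 * h ^ 2 * K ^ 2) * c) M hK); [|easy].
apply Rmult_lt_0_compat; [|easy].
pose proof (Rmult_lt_0_compat _ _ (pow_lt h 2 hh) (pow_lt K 2 hK)); lra.
Qed.

End Vortex.

Theorem mainTheorem3 (h c K : R) (q1 q2 : R -> R)
  (hh : 0 < h) (hc : 0 < c) (hK : 0 < K)
  (hhK : 0 < 3 - 2 * h ^ 2 * K ^ 2)
  (hq : vortex_solution h c K q1 q2) :
  (exists C : R, forall t : R, vortex_invariant h c K (q1 t) t = C) /\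
  (exists q1_plus q1_minus : R,
    is_lim q1 p_infty (Finite q1_plus) /\
    is_lim q1 m_infty (Finite q1_minus) /\
    q1_plus - q1_minus =
      4 * h / sqrt (3 - 2 * h ^ 2 * K ^ 2) *
      atan (2 * h * K / sqrt (3 - 2 * h ^ 2 * K ^ 2))) /\
  (exists M : R, forall t : R, Rabs (q1 t) <= M /\ Rabs (q2 t) <= M).
Proof.
split; [|split].
- exists (vortex_invariant h c K (q1 0) 0); intro t; now apply (invariant_const h c K q1 q2).
- destruct (phase_lim h c K q1 q2) as [Hp Hm]; try easy.
  eexists; eexists; split; [|split].
  (* Time and phase have opposite signs at infinity: late times give [tanh] the limit -1. *)
  + apply (q1_lim h c K q1 q2) with (y := m_infty); try easy;
    [apply is_lim_tanh_m|now exists 0].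
  + apply (q1_lim h c K q1 q2) with (y := p_infty); try easy;
    [apply is_lim_tanh_p|now exists 0].
  + pose proof (sqrt_lt_R0 _ hhK) as Hs; set (s := sqrt _) in *.
    (* Since [atan] is odd, the two end values add up, turning [2 * h] into [4 * h]. *)
    replace (2 * h * K * -1 / s) with (- (2 * h * K / s)) by (field; lra).
    replace (2 * h * K * 1 / s) with (2 * h * K / s) by (field; lra).
    rewrite atan_opp; field; lra.
- destruct (q1_bounded h c K q1 q2) as [M1 H1]; try easy.
  destruct (q2_bounded h c K q1 q2) as [M2 H2]; try easy.
  exists (Rmax M1 M2); intro t; split.
  + eapply Rle_trans; [apply H1|apply Rmax_l].
  + eapply Rle_trans; [apply H2|apply Rmax_r].
Qed.
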